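(* Assume the axiom of choice. Let $(V,\Sigma,\nu)$ be an infinite measure space of voters with $\nu$ atomless and $\nu(V)=1$, and let $C=\{c_1,c_2,c_3\}$. Then there exists a strongly non-Borda social welfare function on $V$ and $C$ satisfying CC (Condorcet cycle domain), MIIA, A (anonymity), N (neutrality) and P (Pareto).
   Context: Setting. $\mathfrak{R}$ is the set of bijections $r:C\to\{0,1,2\}$ (rankings; a larger value means ranked higher), with the discrete $\sigma$-algebra; a ranking is also written as a list from best to worst, so $c_1c_2c_3$ is $c_i\mapsto 3-i$. $\mathfrak{R}_=$ is the set of weak orderings $\succ$ of $C$ (an equivalence relation of tying together with a total order of winning on the classes; $c_i\succ c_j$ means $c_i$ strictly beats $c_j$). A social welfare function (SWF) is a function $F:E\to\mathfrak{R}_=$ where $E$ is a set of measurable functions $V\to\mathfrak{R}$ (elections). For $i\neq j$: $\pi_{i,j}(r)=r(c_i)-r(c_j)\in D_3=\{-2,-1,1,2\}$; for $e\in E$, $\pi_{i,j}(e):V\to D_3$ is $v\mapsto\pi_{i,j}(e(v))$; $A_{i,j}=\pi_{i,j}(E)$; for $\succ\in\mathfrak{R}_=$, $\pi_{i,j}(\succ)=W$ if $c_i\succ c_j$, $L$ if $c_j\succ c_i$, $T$ otherwise. Conditions on $F$: - CC: $E$ is the set of all measurable functions $V\to\mathfrak{C}$ where $\mathfrak{C}=\{c_1c_2c_3,\ c_2c_3c_1,\ c_3c_1c_2\}$. - MIIA: for all $i\ne j$ there is $f_{i,j}:A_{i,j}\to\{W,T,L\}$ with $f_{i,j}(\pi_{i,j}(e))=\pi_{i,j}(F(e))$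 for all $e\in E$. - A: $F(e)$ depends only on $\tau(e)\in\mathbb{R}_{\ge0}^{\mathfrak{R}}$, $\tau(e)(r)=\nu(e^{-1}(r))$. - N: for every permutation $\rho$ of $C$ and all $e\in E$ with $\rho\circ e\in E$, $F(\rho\circ e)=\rho(F(e))$. Here $(\rho\circ e)(v)=\rho(e(v))$ with $\rho(r)=r\circ\rho^{-1}$, and $\rho(\succ)$ is the weak ordering in which $\rho(c_i)$ beats $\rho(c_j)$ iff $c_i\succ c_j$. - P: if $\pi_{i,j}(e)(v)>0$ for all $v\in V$ then $\pi_{i,j}(F(e))=W$. Borda rules: for an integrable weight function $w:V\to\mathbb{R}$, the Borda rule $B_w$ is the SWF ranking candidates by the score $b_w(c,e)=\int_V e(v)(c)\,w(v)\,d\nu(v)$ (i.e. $c_i$ beats $c_j$ iff $b_w(c_i,e)>b_w(c_j,e)$). The tie rule is the SWF under which all candidates are always tied (the case $w\equiv0$). $F$ is weakly Borda if there is $w$, not almost everywhere zero (i.e. $B_w$ is not the tie rule), such that for all $e\in E$ and $i\neq j$, $\pi_{i,j}(B_w(e))\neq T$ implies $\pi_{i,j}(F(e))=\pi_{i,j}(B_w(e))$. $F$ is strongly non-Borda if it is neither weakly Borda nor the tie rule. *)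

(* Defs.v *)
From HB Require Import structures.
From mathcomp Require Import all_boot all_order all_algebra fingroup perm.
From mathcomp Require Import all_classical all_reals all_analysis.

Set Implicit Arguments.
Unset Strict Implicit.
Unset Printing Implicit Defensive.

Import Order.TTheory GRing.Theory Num.Theory.

Local Open Scope classical_set_scope.
Local Open Scope ring_scope.

(* The candidates c_1, c_2, c_3 are the elements 0, 1, 2 of 'I_3. *)
Definition candidate := 'I_3.
Definition c1 : candidate := @Ordinal 3 0 isT.
Definition c2 : candidate := @Ordinal 3 1 isT.
Definition c3 : candidate := @Ordinal 3 2 isT.

(* A ranking is a bijection from the candidates to {0, 1, 2}; since candidates
   are themselves encoded as 'I_3, this is a permutation of 'I_3. The value
   r c is the position of c, a larger value being better. *)
Definition ranking := {perm 'I_3}.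

HB.instance Definition _ := Finite.on ranking.
HB.instance Definition _ := isPointed.Build ranking (1%g : {perm 'I_3}).
HB.instance Definition _ := @isMeasurable.Build default_measure_display
  ranking discrete_measurable discrete_measurable0
  discrete_measurableC discrete_measurableU.

Definition position (r : ranking) (c : candidate) : nat := (r : {perm 'I_3}) c.

(* r is the ranking written "a b c", from best to worst. *)
Definition listed (r : ranking) (a b c : candidate) : Prop :=
  [/\ position r a = 2%N, position r b = 1%N & position r c = 0%N].

Definition condorcet_cycle : set ranking :=
  [set r | [\/ listed r c1 c2 c3, listed r c2 c3 c1 | listed r c3 c1 c2]].

(* rho(r) = r \o rho^-1; the product of permutations composes from left to
   right. *)
Definition permute_ranking (rho : {perm candidate}) (r : ranking) : ranking :=
  (rho^-1 * (r : {perm 'I_3}))%g.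

Definition margin (i j : candidate) (r : ranking) : int :=
  (position r i)%:Z - (position r j)%:Z.

(* An equivalence relation of tying together with a strict total order of
   winning on its classes. *)
Record weak_order := WeakOrder {
  tie : rel candidate;
  win : rel candidate;
  tie_equiv : equivalence_rel tie;
  win_tie : forall i i' j j', tie i i' -> tie j j' -> win i j = win i' j';
  win_ntie : forall i j, win i j -> ~~ tie i j;
  win_trans : transitive win;
  win_total : forall i j, ~~ tie i j -> win i j || win j i
}.

Section permute_order.
Variables (rho : {perm candidate}) (o : weak_order).

Let ptie : rel candidate := fun i j => tie o ((rho^-1)%g i) ((rho^-1)%g j).
Let pwin : rel candidate := fun i j => win o ((rho^-1)%g i) ((rho^-1)%g j).

Let ptie_equiv : equivalence_rel ptie.
Proof. by move=> x y z; apply: tie_equiv. Qed.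
Let pwin_tie i i' j j' : ptie i i' -> ptie j j' -> pwin i j = pwin i' j'.
Proof. exact: win_tie. Qed.
Let pwin_ntie i j : pwin i j -> ~~ ptie i j.
Proof. exact: win_ntie. Qed.
Let pwin_trans : transitive pwin.
Proof. by move=> y x z; apply: win_trans. Qed.
Let pwin_total i j : ~~ ptie i j -> pwin i j || pwin j i.
Proof. exact: win_total. Qed.

Definition permute_order : weak_order :=
  WeakOrder ptie_equiv pwin_tie pwin_ntie pwin_trans pwin_total.

Lemma permute_orderE (i j : candidate) :
  win permute_order (rho i) (rho j) = win o i j.
Proof. by rewrite /= /pwin !permK. Qed.

End permute_order.

Section score_order.
Variables (R : realType) (s : candidate -> R).

Let stie : rel candidate := fun i j => s i == s j.
Let swin : rel candidate := fun i j => s j < s i.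

Let stie_equiv : equivalence_rel stie.
Proof. by move=> x y z; rewrite /stie; split=> // /eqP ->. Qed.
Let swin_tie i i' j j' : stie i i' -> stie j j' -> swin i j = swin i' j'.
Proof. by rewrite /stie /swin => /eqP -> /eqP ->. Qed.
Let swin_ntie i j : swin i j -> ~~ stie i j.
Proof. by rewrite /stie /swin => /gt_eqF ->. Qed.
Let swin_trans : transitive swin.
Proof. by move=> y x z; rewrite /swin => yx zy; apply: lt_trans yx. Qed.
Let swin_total i j : ~~ stie i j -> swin i j || swin j i.
Proof. by rewrite /stie /swin eq_sym => /lt_total. Qed.

Definition score_order : weak_order :=
  WeakOrder stie_equiv swin_tie swin_ntie swin_trans swin_total.

End score_order.

Inductive result := W | T | L.

Definition outcome (i j : candidate) (o : weak_order) : result :=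
  if win o i j then W else if win o j i then L else T.

Definition atomless d (V : measurableType d) (R : realType)
    (nu : set V -> \bar R) : Prop :=
  forall A : set V, measurable A -> (0 < nu A)%E ->
    exists B : set V,
      [/\ measurable B, B `<=` A, (0 < nu B)%E & (nu B < nu A)%E].

Notation election V := {mfun V >-> ranking}.

Definition swf d (V : measurableType d) (E : set (election V)) : Type :=
  E -> weak_order.

Section social_welfare.
Context d (V : measurableType d) (R : realType) (nu : probability V R).
Variables (E : set (election V)).

Definition margins (i j : candidate) (e : election V) : V -> int :=
  fun v => margin i j (e v).

Definition tally (e : election V) (r : ranking) : R :=
  fine (nu (e @^-1` [set r])).

Definition CC : Prop := E = [set e | forall v, condorcet_cycle (e v)].

(* The domain of f is the set A_{i,j} of margin functions of elections. *)
Definition MIIA (F : swf E) : Prop :=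
  forall i j : candidate, i != j ->
    exists f : (margins i j @` E) -> result,
      forall (e : E) (a : margins i j @` E),
        \val a = margins i j (\val e) -> f a = outcome i j (F e).

Definition anonymity (F : swf E) : Prop :=
  forall e e' : E, tally (\val e) =1 tally (\val e') -> F e = F e'.

(* The hypothesis on e' says that it is rho \o e, which is thus in E. *)
Definition neutrality (F : swf E) : Prop :=
  forall (rho : {perm candidate}) (e e' : E),
    (forall v, \val e' v = permute_ranking rho (\val e v)) ->
    F e' = permute_order rho (F e).

Definition pareto (F : swf E) : Prop :=
  forall (i j : candidate) (e : E), i != j ->
    (forall v, 0 < margins i j (\val e) v) -> outcome i j (F e) = W.

Definition borda_score (w : V -> R) (e : election V) (c : candidate) : R :=
  \int[nu]_v ((position (e v) c)%:R * w v).

Definition borda (w : V -> R) : swf E :=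
  fun e => score_order (borda_score w (\val e)).

Definition is_tie_rule (F : swf E) : Prop :=
  forall (e : E) (i j : candidate), tie (F e) i j.

Definition weakly_borda (F : swf E) : Prop :=
  exists w : V -> R,
    [/\ nu.-integrable setT (EFin \o w),
        ~ {ae nu, forall v, w v = 0} &
        forall (e : E) (i j : candidate), i != j ->
          outcome i j (borda w e) <> T ->
          outcome i j (F e) = outcome i j (borda w e)].

Definition strongly_non_borda (F : swf E) : Prop :=
  ~ weakly_borda F /\ ~ is_tie_rule F.

End social_welfare.

(* Main.v *)
(** Let [phi : R -> R] be linear over the rationals, with [phi 1 = 1], but not of
    the form [x |-> c * x].  Rank the candidates by [phi] of their unweighted Borda
    score.  The outcome between [i] and [j] is then the sign of [phi] at the
    integral of the margin, which gives MIIA, anonymity and neutrality on any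
    domain; on Condorcet cycles a positive margin is constant, which gives Pareto.
    Suppose that a weight [w], not almost everywhere zero, made this rule weakly
    Borda.  In an election where the voters of [A] rank 231 and the others 123,
    the [w]-Borda margin of [c1] over [c2] is the integral of [w] minus three
    times its integral over [A].  Choose [A] such that this is not zero.  Removing
    from [A] a set of small measure [t] keeps its sign, but
    [phi (1 - 3 * (nu A - t))] takes both signs for arbitrarily small [t], and
    every [t] is attained because [nu] is atomless. *)

Require Import Defs.
From HB Require Import structures.
From mathcomp Require Import all_boot all_order all_algebra fingroup perm.
From mathcomp Require Import all_classical all_reals all_analysis.
From mathcomp Require Import ring lra.

Set Implicit Arguments.
Unset Strict Implicit.
Unset Printing Implicit Defensive.

Import Order.TTheory GRing.Theory Num.Theory.
Import numFieldNormedType.Exports.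

Local Open Scope classical_set_scope.
Local Open Scope ring_scope.

(** * Functions linear over the rationals *)

Section rational_linear.
Variable R : realType.
Implicit Types (phi : R -> R) (q : rat) (x y : R).

Definition rational_linear phi :=
  forall q x y, phi (ratr q * x + y) = ratr q * phi x + phi y.

Lemma rational_linear0 phi : rational_linear phi -> phi 0 = 0.
Proof.
move=> lphi; have := lphi 1 0 0; rewrite rmorph1 mulr0 addr0 mul1r => h.
by apply: (@addrI _ (phi 0)); rewrite -h addr0.
Qed.

Lemma rational_linearZ phi q x :
  rational_linear phi -> phi (ratr q * x) = ratr q * phi x.
Proof.
by move=> lphi; rewrite -[X in phi X]addr0 lphi (rational_linear0 lphi) addr0.
Qed.

Lemma rational_linearD phi x y :
  rational_linear phi -> phi (x + y) = phi x + phi y.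
Proof. by move=> lphi; have := lphi 1 x y; rewrite rmorph1 !mul1r. Qed.

Lemma rational_linearB phi x y :
  rational_linear phi -> phi (x - y) = phi x - phi y.
Proof.
by move=> lphi; have := lphi (-1) y x; rewrite rmorphN1 !mulN1r ![- _ + _]addrC.
Qed.

Lemma rational_linear_int phi (z : int) :
  rational_linear phi -> phi z%:~R = z%:~R * phi 1.
Proof. by move=> lphi; rewrite -(ratr_int R z) -rational_linearZ // mulr1. Qed.

(* Zorn gives a maximal rational subspace K avoiding 1. By maximality K and the
   rational line span R, and phi is the projection onto that line along K. *)
Lemma ex_rational_linear_projection : exists phi,
  [/\ rational_linear phi, phi 1 = 1 & forall x, rational (phi x)].
Proof.
pose P (K : set R) :=
  (forall q x y, K x -> K y -> K (ratr q * x + y)) /\ ~ K 1.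
have [|K [[Klin K1] Kmax]] := @Zorn_bigcup R P.
  move=> F FP Ftot; split=> [q x y [X FX Xx] [Y FY Yy]|[X FX X1]].
    case: (Ftot X Y FX FY) => sXY.
      by exists Y => //; apply: (FP Y FY).1 => //; exact: sXY.
    by exists X => //; apply: (FP X FX).1 => //; exact: sXY.
  by case: (FP X FX).
have K0 : K 0.
  have [[x Kx]|noK] := pselect (exists x, K x).
    by have := Klin (-1) x x Kx Kx; rewrite rmorphN1 mulN1r addNr.
  (* [P] admits the empty set, so an empty [K] has to be excluded by maximality, against the zero
     subspace. *)
  exfalso; apply: (Kmax [set 0]); first split.
  - by move=> x Kx; case: noK; exists x.
  - by move=> /(_ 0 erefl) K0; case: noK; exists 0.
  - split=> [q x y -> ->|/= /eqP]; first by rewrite mulr0 addr0.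
    by rewrite oner_eq0.
have KZ q x : K x -> K (ratr q * x).
  by move=> Kx; rewrite -[X in K X]addr0; exact: Klin.
have Kdec x : exists q, K (x - ratr q).
  have [Kx|nKx] := pselect (K x); first by exists 0; rewrite raddf0 subr0.
  (* [B] is the span of [K] and [x]. If it contains 1, solving [1 = q x + k] for [x] gives [x - 1/q]
     in [K]; otherwise it contradicts maximality. *)
  pose B : set R := [set z | exists q k, K k /\ z = ratr q * x + k].
  have [[q [k [Kk E]]]|nB1] := pselect (B 1).
    have q0 : q != 0.
      by apply: contra_notN K1 => /eqP q0; rewrite E q0 raddf0 mul0r add0r.
    have rq0 : ratr q != 0 :> R by rewrite fmorph_eq0.
    exists q^-1; rewrite (_ : _ - _ = ratr (- q^-1) * k); first exact: KZ.
    rewrite rmorphN fmorphV /=.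
    have -> : k = 1 - ratr q * x by rewrite E; ring.
    by field.
  exfalso; apply: (Kmax B); first split.
  - by move=> k Kk; exists 0, k; rewrite raddf0 mul0r add0r.
  - by move=> BK; apply: nKx; apply: BK; exists 1, 0; rewrite rmorph1 mul1r addr0.
  - split=> // q _ _ [q1 [k1 [K1' ->]]] [q2 [k2 [K2 ->]]].
    exists (q * q1 + q2), (ratr q * k1 + k2); split; first exact: Klin.
    by rewrite rmorphD rmorphM /=; ring.
pose f x := projT1 (cid (Kdec x)).
have fK x : K (x - ratr (f x)) by exact: (projT2 (cid (Kdec x))).
(* Two different such rationals would put their difference into [K], and then 1 by scaling. This
   uniqueness is what makes the chosen [f] linear. *)
have funiq x q : K (x - ratr q) -> f x = q.
  move=> Kq; apply/eqP; rewrite -subr_eq0; apply: contra_notT K1 => fq.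
  have fq0 : ratr (f x - q) != 0 :> R by rewrite fmorph_eq0.
  rewrite -(mulVf fq0) -fmorphV; apply: KZ.
  rewrite rmorphB /= (_ : _ - _ = ratr (-1) * (x - ratr (f x)) + (x - ratr q)).
    exact: Klin.
  by rewrite rmorphN1; ring.
exists (ratr \o f); split=> [q x y||x]; last by exists (f x).
- rewrite /= -rmorphM -rmorphD /=; congr ratr; apply: funiq.
  rewrite rmorphD rmorphM /= (_ : _ - _ = ratr q * (x - ratr (f x)) + (y - ratr (f y))).
    exact: Klin.
  by ring.
- by rewrite /= (funiq _ 1) ?rmorph1 // subrr.
Qed.

Lemma rat_mul_gt (M b : R) : b != 0 -> exists q, M < ratr q * b.
Proof.
rewrite neq_lt => /orP[b0|b0].
  have [|q] := @rat_in_itvoo R (M / b - 1) (M / b); first lra.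
  by rewrite in_itv /= => /andP[_]; rewrite ltr_ndivlMr // => ?; exists q.
have [|q] := @rat_in_itvoo R (M / b) (M / b + 1); first lra.
by rewrite in_itv /= => /andP[]; rewrite ltr_pdivrMr // => ? _; exists q.
Qed.

(* Take t = q x - p with rationals p and q: then
   phi t = q (phi x - x phi 1) + t phi 1, where q is free. *)
Lemma rational_linear_unbounded phi (x M e : R) :
  rational_linear phi -> phi x != x * phi 1 -> 0 < e ->
  exists t, [/\ 0 < t, t < e & M < phi t].
Proof.
move=> lphi nx e0.
(* The slack [e * |phi 1|] absorbs the term [t * phi 1], because [0 < t < e]. *)
move: nx; rewrite -subr_eq0 => /(rat_mul_gt (M + e * `|phi 1|))[q Mq].
have [|p] := @rat_in_itvoo R (ratr q * x - e) (ratr q * x); first lra.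
rewrite in_itv /= => /andP[p1 p2]; exists (ratr q * x - ratr p).
split; [lra|lra|].
have -> : phi (ratr q * x - ratr p) =
    ratr q * (phi x - x * phi 1) + (ratr q * x - ratr p) * phi 1.
  rewrite (rational_linearB _ _ lphi) rational_linearZ //.
  by rewrite -[X in _ - phi X]mulr1 rational_linearZ //; ring.
suff : `|(ratr q * x - ratr p) * phi 1| <= e * `|phi 1|.
  by rewrite ler_norml => /andP[]; lra.
by rewrite normrM ler_wpM2r // ger0_norm; lra.
Qed.

End rational_linear.

(** * Intermediate values of an atomless probability measure *)

Section atomless_measure.
Context d (V : measurableType d) (R : realType) (nu : probability V R).
Implicit Types A B C : set V.

Let m A := fine (nu A).

Let mE A : measurable A -> nu A = (m A)%:E.
Proof. by move=> mA; rewrite /m fineK // fin_num_measure. Qed.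

Let m_ge0 A : 0 <= m A.
Proof. by rewrite /m fine_ge0. Qed.

Let le_m A B : measurable A -> measurable B -> A `<=` B -> m A <= m B.
Proof. by move=> mA mB AB; rewrite -lee_fin -!mE // le_measure ?inE. Qed.

Lemma fine_measureD A B : measurable A -> measurable B -> B `<=` A ->
  m (A `\` B) = m A - m B.
Proof.
move=> mA mB BA; apply: EFin_inj; rewrite EFinB -!mE //; last exact: measurableD.
by rewrite measureD ?setIidr // -?ge0_fin_numE ?fin_num_measure.
Qed.

(** Repeated halving: atomlessness splits a set of positive measure into two parts of positive
    measure, one of which has at most half the measure. *)
Lemma atomless_small A (e : R) : atomless nu ->
  measurable A -> (0 < nu A)%E -> 0 < e ->
  exists B, [/\ measurable B, B `<=` A, (0 < nu B)%E & (nu B <= e%:E)%E].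
Proof.
move=> nu_atomless mA A0 e0.
suff halving n : exists B,
    [/\ measurable B, B `<=` A, 0 < m B & m B * 2 ^+ n <= 1].
  have [n en] : exists n, e^-1 < 2 ^+ n.
    exists (Num.truncn e^-1).+1.
    rewrite (lt_trans (truncnS_gt _)) // -natrX ltr_nat; exact: ltn_expl.
  have [B [mB BA B0 Bn]] := halving n.
  exists B; rewrite mE // lte_fin lee_fin; split=> //.
  rewrite -(@ler_pM2r _ (2 ^+ n)) ?exprn_gt0 //; apply: le_trans Bn _.
  by rewrite -[X in X <= _](mulfV (lt0r_neq0 e0)) ler_wpM2l ?ltW.
elim: n => [|n [B [mB BA B0 Bn]]].
  exists A; split=> //; first by rewrite -lte_fin -mE.
  by rewrite expr0 mulr1 -lee_fin -mE // probability_le1.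
have [|C [mC CB C0 CltB]] := nu_atomless B mB; first by rewrite mE.
rewrite mE // lte_fin in C0; rewrite !mE // lte_fin in CltB.
have [Csmall|Cbig] := leP (m C) (m B / 2).
  exists C; split=> //; first exact: subset_trans BA.
  rewrite exprS mulrA; apply: le_trans Bn.
  by rewrite ler_wpM2r ?exprn_ge0 //; lra.
have mD := fine_measureD mB mC CB.
exists (B `\` C); split; [exact: measurableD| |by rewrite mD; lra|].
  by move=> x [/BA].
rewrite exprS mulrA; apply: le_trans Bn.
by rewrite ler_wpM2r ?exprn_ge0 // mD; lra.
Qed.

(* Greedy exhaustion: the largest admissible increment may not be attained, so
   half of it is all that can be asked for. *)
Let greedy A (t : R) B : measurable A -> measurable B -> B `<=` A -> m B <= t ->
  exists C, [/\ measurable C, B `<=` C, C `<=` A, m C <= t &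
    forall D, measurable D -> D `<=` A `\` B -> m B + m D <= t ->
      m D <= 2 * (m C - m B)].
Proof.
move=> mA mB BA Bt.
pose G D := [/\ measurable D, D `<=` A `\` B & m B + m D <= t].
have m0 : m set0 = 0 by rewrite /m measure0.
pose S := [set m D | D in G].
have S_sup : has_sup S.
  split; first by exists 0, set0 => //; split=> //; rewrite m0 addr0.
  by exists (t - m B) => _ [D [_ _ Dt] <-]; lra.
have subS D : G D -> m D <= sup S.
  by move=> GD; apply: ub_le_sup; [exact: S_sup.2|exists D].
have [S0|S0] := leP (sup S) 0.
  exists B; split=> // D mD DAB Dt; rewrite subrr mulr0.
  by apply: le_trans S0; apply: subS.
have [||_ [D [mD DAB Dt] <-] SD] := @sup_gt _ S (sup S / 2).
- by have := S_sup.1.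
- lra.
have BD0 : B `&` D = set0 by apply/disjoints_subset => x Bx /DAB[].
have mBD : m (B `|` D) = m B + m D.
  by apply: EFin_inj; rewrite EFinD -!mE ?measureU //; exact: measurableU.
exists (B `|` D); split=> //; first exact: measurableU.
- by move=> x [/BA|/DAB[]].
- by rewrite mBD.
- by move=> D' mD' D'A D't; have := subS D' (And3 mD' D'A D't); rewrite mBD; lra.
Qed.

(** Sierpinski's theorem. Greedy steps from the empty set give an increasing sequence of subsets of
    [A] of measure at most [t], and its union has measure exactly [t]. *)
Lemma atomless_subset A (t : R) : atomless nu ->
  measurable A -> 0 <= t -> (t%:E <= nu A)%E ->
  exists B, [/\ measurable B, B `<=` A & nu B = t%:E].
Proof.
move=> nu_atomless mA t0; rewrite mE // lee_fin => tA.
pose P B := [/\ measurable B, B `<=` A & m B <= t].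
(* The premise [P B] stands under the existential so that [choice] yields a function on all sets;
   where [P B] fails, any value will do. *)
have step B : exists C, P B -> [/\ P C, B `<=` C &
    forall D, measurable D -> D `<=` A `\` B -> m B + m D <= t ->
      m D <= 2 * (m C - m B)].
  have [[mB BA Bt]|nPB] := pselect (P B); last by exists B.
  by have [C [mC BC CA Ct CD]] := greedy mA mB BA Bt; exists C.
have [next nextP] := choice step.
pose B n := iter n next set0.
have PB n : P (B n).
  elim: n => [|n /nextP[]] //.
  by split; [exact: measurable0|exact: sub0set|rewrite /= /m measure0].
have mB n : measurable (B n) by have [] := PB n.
have Bmono : {homo B : n p / (n <= p)%N >-> (n <= p)%O}.
  apply: homo_leq => [X|X Y Z|n]; [exact: lexx|exact: le_trans|].
  by apply/subsetPset; have [] := nextP _ (PB n).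
pose U := \bigcup_n B n.
have mU : measurable U by exact: bigcup_measurable.
have UA : U `<=` A by move=> x [n _]; have [_ + _] := PB n; apply.
have BU n : B n `<=` U by move=> x Bx; exists n.
have Ut : m U <= t.
  rewrite -lee_fin -mE //; have Ucvg := nondecreasing_cvg_mu (mu := nu) mB mU Bmono.
  rewrite -(cvg_lim _ Ucvg) //; apply: lime_le.
    by apply/cvg_ex; eexists; exact: Ucvg.
  by apply: nearW => n /=; rewrite mE // lee_fin; have [] := PB n.
exists U; split=> //; rewrite mE //; congr EFin; apply/eqP.
rewrite eq_le Ut leNgt; apply/negP => Ut'.
have mAU := measurableD mA mU; have AU := fine_measureD mA mU UA.
(* If [U] falls short of [t], some [D] of positive measure outside [U] fits into the gap. It was
   admissible at every stage, so each stage gained at least half of [m D]. *)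
have [||D [mD DAU D0 Dt]] := atomless_small (e := t - m U) nu_atomless mAU.
- by rewrite mE // lte_fin AU; lra.
- lra.
rewrite mE // lte_fin in D0; rewrite mE // lee_fin in Dt.
have Bgrow n : n%:R * m D <= 2 * m (B n).
  elim: n => [|n IH]; first by rewrite mul0r mulr_ge0.
  have [_ _ /(_ D mD)] := nextP _ (PB n).
  rewrite -/(B n.+1) => h.
  suff : m D <= 2 * (m (B n.+1) - m (B n)) by rewrite -natr1; lra.
  apply: h; first by move=> x /DAU[Ax nUx]; split=> // /BU.
  by have := le_m (mB n) mU (BU n); lra.
(* For this index [n], [n * m D] exceeds [2 * t], although [m (B n)] is at most [t]. *)
have := Bgrow (Num.truncn (2 * t / m D)).+1.
have [_ _ Bt] := PB (Num.truncn (2 * t / m D)).+1.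
have := truncnS_gt (2 * t / m D); rewrite ltr_pdivrMr //; lra.
Qed.

End atomless_measure.

(** * Outcomes, weak orders and rankings *)

Definition result_of_sign (R : realType) (x : R) : result :=
  if 0 < x then W else if x < 0 then L else T.

Lemma result_of_sign_inj (R : realType) (x y : R) :
  result_of_sign x = result_of_sign y -> Num.sg x = Num.sg y.
Proof. by rewrite /result_of_sign; do 2 case: sgrP. Qed.

Lemma result_of_sign_T (R : realType) (x : R) : result_of_sign x = T -> x = 0.
Proof. by rewrite /result_of_sign; case: ltgtP. Qed.

Lemma outcome_score_order (R : realType) (s : candidate -> R) i j :
  outcome i j (score_order s) = result_of_sign (s i - s j).
Proof. by rewrite /outcome /result_of_sign /= subr_gt0 subr_lt0. Qed.

(** Neutrality is an equality of records, so the proof fields must be identified as well; proof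
    irrelevance does this. *)
Lemma eq_weak_order (o o' : weak_order) :
  tie o =2 tie o' -> win o =2 win o' -> o = o'.
Proof.
case: o o' => [t w p1 p2 p3 p4 p5] [t' w' q1 q2 q3 q4 q5] /= tE wE.
have t't : t' = t by apply/funext => i; apply/funext => j.
have w'w : w' = w by apply/funext => i; apply/funext => j.
by subst t' w'; congr WeakOrder; exact: Prop_irrelevance.
Qed.

Lemma eq_score_order (R : realType) (s s' : candidate -> R) :
  s =1 s' -> score_order s = score_order s'.
Proof. by move/funext => ->. Qed.

Lemma permute_score_order (R : realType) (rho : {perm candidate})
    (s s' : candidate -> R) :
  (forall c, s' c = s ((rho^-1)%g c)) ->
  score_order s' = permute_order rho (score_order s).
Proof. by move=> ss; apply: eq_weak_order => i j /=; rewrite !ss. Qed.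

Lemma position_permute (rho : {perm candidate}) r c :
  position (permute_ranking rho r) c = position r ((rho^-1)%g c).
Proof. by rewrite /position /permute_ranking permM. Qed.

Lemma candidateP (c : candidate) : [\/ c = c1, c = c2 | c = c3].
Proof.
case: c => [[|[|[|//]]] c_lt]; [apply: Or31|apply: Or32|apply: Or33]; exact: val_inj.
Qed.

(** The three rankings differ by cyclic shifts of the positions, so the margin is constant modulo 3:
    it ranges over 1 and -2, or over 2 and -1. *)
Lemma margin_condorcet i j r r' : condorcet_cycle r -> condorcet_cycle r' ->
  0 < margin i j r -> 0 < margin i j r' -> margin i j r = margin i j r'.
Proof.
rewrite /margin.
by case=> -[r1 r2 r3]; case=> -[r'1 r'2 r'3];
  case: (candidateP i) => ->; case: (candidateP j) => ->;
  rewrite ?(r1, r2, r3, r'1, r'2, r'3).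
Qed.

(** Rankings send candidates to positions and 2 is the best position, so the list 123 is a
    transposition and not the identity. *)
Definition ranking123 : ranking := tperm c1 c3.
Definition ranking231 : ranking := tperm c2 c3.

Lemma listed123 : listed ranking123 c1 c2 c3.
Proof. by split; rewrite /position /ranking123 ?tpermL ?tpermR ?tpermD. Qed.

Lemma listed231 : listed ranking231 c2 c3 c1.
Proof. by split; rewrite /position /ranking231 ?tpermL ?tpermR ?tpermD. Qed.

(** * Elections and integrals over the voters *)

Section elections.
Context d (V : measurableType d) (R : realType) (nu : probability V R).
Implicit Types (e : election V) (w : V -> R) (A : set V).

Lemma measurable_ranking_preimage e (Y : set ranking) : measurable (e @^-1` Y).
Proof. by rewrite -[X in measurable X]setTI; exact: measurable_funPT. Qed.

Lemma ex_two_valued_election A (r r' : ranking) : measurable A ->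
  exists e, forall v, e v = if v \in A then r else r'.
Proof.
move=> mA; pose f v : ranking := if v \in A then r else r'.
have mf : f \in mfun.
  apply/mem_set; apply: measurable_fun_ifT => //.
  by apply: (measurable_fun_bool true); rewrite setTI preimage_mem_true.
by exists (mfun_Sub mf).
Qed.

Section integral.
Variables (e : election V) (w : V -> R).
Hypothesis w_int : nu.-integrable setT (EFin \o w).

(** An election takes finitely many values, so [h (e v) * w v] splits into contributions of the
    fibres of [e]. *)
Let piece (h : ranking -> R) (r : ranking) (v : V) : R :=
  h r * (w \_ (e @^-1` [set r])) v.

Let w_rank_int r : nu.-integrable setT (EFin \o (w \_ (e @^-1` [set r]))).
Proof.
rewrite -restrict_EFin; apply/integrable_restrict => //.
  exact: measurable_ranking_preimage.
rewrite setTI; apply: integrableS w_int => //.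
exact: measurable_ranking_preimage.
Qed.

Let piece_int h r : nu.-integrable setT (EFin \o piece h r).
Proof.
have := @integrableZl _ _ _ nu _ measurableT (h r) _ (w_rank_int r).
by apply: eq_integrable.
Qed.

(** Integrability and the formula are proved together, since additivity in the induction step needs
    the tail to be integrable. *)
Let sum_piece h (s : seq ranking) :
  nu.-integrable setT (EFin \o (fun v => \sum_(r <- s) piece h r v)) /\
  \int[nu]_v (\sum_(r <- s) piece h r v) =
    \sum_(r <- s) h r * \int[nu]_(v in e @^-1` [set r]) w v.
Proof.
elim: s => [|r s [s_int sE]].
  under eq_fun do rewrite big_nil; rewrite big_nil Rintegral_cst // mul0r.
  by split=> //; exact: finite_measure_integrable_cst.
under eq_fun do rewrite big_cons; rewrite big_cons RintegralD // sE; split.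
  exact: (integrableD measurableT (piece_int h r) s_int).
by rewrite RintegralZl // -Rintegral_mkcond.
Qed.

Let sum_pieceE h v : h (e v) * w v = \sum_(r : ranking) piece h r v.
Proof.
rewrite (bigD1 (e v)) //= big1 => [|r re].
  by rewrite addr0 /piece patchE mem_set.
rewrite /piece patchE memNset ?mulr0 //=.
by move=> ev; rewrite ev eqxx in re.
Qed.

Lemma ranking_integrable h :
  nu.-integrable setT (EFin \o (fun v => h (e v) * w v)).
Proof.
under eq_fun do rewrite sum_pieceE.
by have [] := sum_piece h (index_enum ranking).
Qed.

Lemma ranking_integral h : \int[nu]_v (h (e v) * w v) =
  \sum_(r : ranking) h r * \int[nu]_(v in e @^-1` [set r]) w v.
Proof.
under eq_fun do rewrite sum_pieceE.
by have [] := sum_piece h (index_enum ranking).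
Qed.

Lemma borda_scoreB i j : borda_score nu w e i - borda_score nu w e j =
  \int[nu]_v ((margins i j e v)%:~R * w v).
Proof.
rewrite /borda_score -RintegralB //; last 2 first.
- exact: (ranking_integrable (fun r => (position r i)%:R)).
- exact: (ranking_integrable (fun r => (position r j)%:R)).
by apply: eq_Rintegral => v _; rewrite -mulrBl /margins /margin intrB.
Qed.

(** The margin of [c1] over [c2] is 1 in 123 and -2 in 231, hence 1 minus three times the indicator
    of [A]. *)
Lemma margin_two_valued A : measurable A ->
  (forall v, e v = if v \in A then ranking231 else ranking123) ->
  \int[nu]_v ((margins c1 c2 e v)%:~R * w v) =
    \int[nu]_v w v - 3 * \int[nu]_(v in A) w v.
Proof.
move=> mA eE.
have wA : nu.-integrable setT (EFin \o (w \_ A)).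
  rewrite -restrict_EFin; apply/integrable_restrict => //.
  by rewrite setTI; apply: integrableS w_int.
rewrite [X in _ - _ * X]Rintegral_mkcond -RintegralZl // -RintegralB //; last first.
  by have := @integrableZl _ _ _ nu _ measurableT 3 _ wA; apply: eq_integrable.
apply: eq_Rintegral => v _; rewrite /margins eE patchE /margin.
case: ifP => _.
  by have [-> _ ->] := listed231; rewrite intrB -!pmulrn; ring.
(* Outside [A] the restriction of [w] takes the default value [point], which is 0 in [R]. *)
by have [-> -> _] := listed123; rewrite intrB -!pmulrn -[point]/(0 : R); ring.
Qed.

End integral.

Lemma cst1_integrable : nu.-integrable setT (EFin \o (cst 1 : V -> R)).
Proof. exact: finite_measure_integrable_cst. Qed.

(** With unit weight, the integral over the voters with ranking [r] is the tally of [r]. *)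
Lemma eq_tally_borda_score1 e e' c : Defs.tally nu e =1 Defs.tally nu e' ->
  borda_score nu (cst 1) e c = borda_score nu (cst 1) e' c.
Proof.
move=> ee'; rewrite /borda_score.
rewrite !(ranking_integral _ cst1_integrable (fun r => (position r c)%:R)).
apply: eq_bigr => r _.
rewrite !Rintegral_cst ?mul1r; [|exact: measurable_ranking_preimage..].
by congr (_ * _); exact: ee'.
Qed.

End elections.

(** * The Borda rule perturbed by a rationally linear function *)

Section perturbed_borda.
Context d (V : measurableType d) (R : realType) (nu : probability V R).
Variable phi : R -> R.
Hypothesis phi_lin : rational_linear phi.
Implicit Types (w : V -> R) (A B : set V).

Definition condorcet_elections : set (election V) :=
  [set e | forall v, condorcet_cycle (e v)].

Definition perturbed_borda (E : set (election V)) : swf E :=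
  fun e : E => score_order (phi \o borda_score nu (cst 1) (\val e)).

Lemma outcome_perturbed_borda (E : set (election V)) (e : E) i j :
  outcome i j (@perturbed_borda E e) =
  result_of_sign (phi (\int[nu]_v ((margins i j (\val e) v)%:~R * cst 1 v))).
Proof.
rewrite outcome_score_order /= -(rational_linearB _ _ phi_lin).
by rewrite borda_scoreB //; exact: cst1_integrable.
Qed.

Lemma perturbed_borda_MIIA (E : set (election V)) : MIIA (@perturbed_borda E).
Proof.
move=> i j _.
exists (fun a => result_of_sign (phi (\int[nu]_v ((\val a v)%:~R * cst 1 v)))).
by move=> e a ->; rewrite outcome_perturbed_borda.
Qed.

Lemma perturbed_borda_anonymity (E : set (election V)) :
  anonymity nu (@perturbed_borda E).
Proof.
move=> e e' ee'; apply: eq_score_order => c /=.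
by rewrite (eq_tally_borda_score1 c ee').
Qed.

Lemma perturbed_borda_neutrality (E : set (election V)) :
  neutrality (@perturbed_borda E).
Proof.
move=> rho e e' e'E; apply: permute_score_order => c /=; congr phi.
by apply: eq_Rintegral => v _; rewrite e'E position_permute.
Qed.

Lemma perturbed_borda_pareto :
  0 < phi 1 -> pareto (@perturbed_borda condorcet_elections).
Proof.
move=> phi1 i j e _ epos.
have [v0 _] : [set: V] !=set0.
  apply/set0P/eqP => V0; have := probability_setT nu.
  by rewrite V0 measure0 => /eqP; rewrite eq_sym onee_eq0.
have eC v : condorcet_cycle (\val e v) by exact: (set_mem (valP e)).
rewrite outcome_perturbed_borda.
have nuT1 : fine (nu [set: V]) = 1 by rewrite probability_setT.
(* All margins equal that of [v0], so the integral is an integer, and on integers [phi] is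
   multiplication by [phi 1]. *)
pose q : R := (margin i j (\val e v0))%:~R.
have -> : \int[nu]_v ((margins i j (\val e) v)%:~R * cst 1 v) = q.
  rewrite (@eq_Rintegral _ _ _ nu setT (cst q)) => [|v _].
    by rewrite Rintegral_cst // -[RHS]mulr1; congr (_ * _); exact: nuT1.
  rewrite [LHS]mulr1 /margins (margin_condorcet (eC v) (eC v0)) //; exact: epos.
rewrite rational_linear_int //.
by rewrite /result_of_sign mulr_gt0 // ltr0z; exact: epos.
Qed.

(** If [w] has nonzero integral, the whole space will do. Otherwise failure for every [A] makes all
    integrals of [w] over measurable sets vanish, so [w] is almost everywhere zero. *)
Lemma ex_unbalanced_set w : nu.-integrable setT (EFin \o w) ->
  ~ {ae nu, forall v, w v = 0} ->
  exists A, [/\ measurable A, (0 < nu A)%E &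
    \int[nu]_v w v - 3 * \int[nu]_(v in A) w v != 0].
Proof.
move=> w_int wn0.
have [wT|wT] := eqVneq (\int[nu]_v w v) 0; last first.
  exists setT; split=> //; first by rewrite probability_setT lte01.
  by apply: contra_neq wT; lra.
apply: contrapT => noA; apply: wn0.
have wA0 A : measurable A -> \int[nu]_(v in A) w v = 0.
  move=> mA; have [A0|A0] := eqVneq (nu A) 0%E.
    rewrite /Rintegral null_set_integral //.
    by apply: measurable_int (integrableS _ _ _ w_int).
  have [//|wA] := eqVneq (\int[nu]_(v in A) w v) 0.
  exfalso; apply: noA; exists A; split=> //.
    by rewrite lt0e A0 /=.
  by apply: contra_neq wA; rewrite wT; lra.
have := @integral_ae_eq _ _ _ nu setT measurableT (cst 0%E) _ w_int.
move=> /(_ _ _) []//.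
- move=> A _ mA; rewrite integral0 -[LHS]fineK.
    by congr EFin; exact: wA0.
  by apply: integrable_fin_num => //; exact: integrableS w_int.
- move=> N [mN N0 NE]; exists N; split=> //.
  by apply: subset_trans NE => v /= wv; apply: contra_not wv => /(_ Logic.I) [].
Qed.

Lemma Rintegral_setD w A B :
  nu.-integrable setT (EFin \o w) -> measurable A -> measurable B -> B `<=` A ->
  \int[nu]_(v in A `\` B) w v =
    \int[nu]_(v in A) w v - \int[nu]_(v in B) w v.
Proof.
move=> w_int mA mB BA; have mAB := measurableD mA mB.
rewrite -[in X in _ = X - _](setDUK BA) Rintegral_setU //.
- by rewrite addrAC subrr add0r.
- rewrite setDUK //; exact: integrableS w_int.
- by apply/disj_setPS => x [Bx []].
Qed.

Lemma perturbed_borda_not_weakly_borda (x : R) : atomless nu ->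
  phi x != x * phi 1 -> ~ weakly_borda nu (@perturbed_borda condorcet_elections).
Proof.
move=> nu_atomless phi_nonlin [w [w_int wn0 wF]].
have [A [mA A0 c0]] := ex_unbalanced_set w_int wn0.
set c := _ - _ in c0.
(* Removing [B] from [A] changes [c] by three times the integral of [w] over [B], which is why a
   third of [|c|] is the threshold. *)
have [del [del0 small]] : exists del : R, 0 < del /\ forall B, measurable B ->
    (nu B < del%:E)%E -> \int[nu]_(v in B) `|w v| < `|c| / 3.
  by apply: integral_normr_continuous => //; rewrite divr_gt0 ?normr_gt0.
pose a := fine (nu A).
have aE : nu A = a%:E by rewrite fineK // fin_num_measure.
have a0 : 0 < a by rewrite -lte_fin -aE.
(* The factor treats both signs of [c] at once: the aim is now to make [phi'] positive at
   [1 - 3 * (a - t)]. *)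
pose phi' y := - Num.sg c * phi y.
have phi'_lin : rational_linear phi'.
  by move=> q y z; rewrite /phi' phi_lin mulrDr mulrCA.
have phi'_nonlin : phi' x != x * phi' 1.
  by rewrite /phi' mulrCA (inj_eq (mulfI _)) // oppr_eq0 sgr_eq0.
(* The lower bound on [phi' t] is what [phi' (1 - 3 * a) + 3 * phi' t > 0] requires; [t < del] keeps
   the sign of [c], and [t < a] lets [B] fit inside [A]. *)
have [|t [t0 tlt phit]] := @rational_linear_unbounded _ phi' x
  (- phi' (1 - 3 * a) / 3) (Num.min del a) phi'_lin phi'_nonlin.
  by rewrite lt_min del0.
move: tlt; rewrite lt_min => /andP[tdel ta].
have [||B [mB BA Bt]] := @atomless_subset _ _ _ nu A t nu_atomless mA.
- exact: ltW.
- by rewrite aE lee_fin ltW.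
have mAB := measurableD mA mB.
have [e eE] := ex_two_valued_election ranking231 ranking123 mAB.
have eC : e \in condorcet_elections.
  apply/mem_set => v; rewrite eE; case: ifP => _.
    by apply: Or32; exact: listed231.
  by apply: Or31; exact: listed123.
have wB : `|\int[nu]_(v in B) w v| < `|c| / 3.
  apply: le_lt_trans (small B mB _); last by rewrite Bt lte_fin.
  by apply: le_normr_Rintegral => //; exact: integrableS w_int.
have sg_w : Num.sg (borda_score nu w e c1 - borda_score nu w e c2) = Num.sg c.
  rewrite borda_scoreB // (margin_two_valued w_int mAB eE).
  rewrite (Rintegral_setD w_int mA mB BA).
  move: wB c0; rewrite ltr_norml => /andP[wB1 wB2].
  rewrite neq_lt => /orP[cneg|cpos].
    rewrite (ltr0_sg cneg) ltr0_sg //; move: wB1 wB2.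
    by rewrite ltr0_norm // /c; lra.
  rewrite (gtr0_sg cpos) gtr0_sg //; move: wB1 wB2.
  by rewrite gtr0_norm // /c; lra.
have := wF (exist _ e eC) c1 c2 isT.
rewrite outcome_score_order outcome_perturbed_borda /= => h.
have {}h := result_of_sign_inj (h _).
have sgF : Num.sg (phi (1 - 3 * (a - t))) = Num.sg c.
  rewrite -sg_w -h; last first.
    move=> /result_of_sign_T E0; move: sg_w c0; rewrite E0 sgr0.
    by move=> /esym/eqP; rewrite sgr_eq0 => ->.
  rewrite (margin_two_valued (cst1_integrable nu) mAB eE).
  have nuT1 : fine (nu [set: V]) = 1 by rewrite probability_setT.
  have nuAB : fine (nu (A `\` B)) = a - t.
    by rewrite fine_measureD // Bt.
  rewrite !Rintegral_cst // !mul1r.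
  by congr (Num.sg (phi (_ - _ * _))); exact: esym.
(* By [sgF] this product is an absolute value, whereas the choice of [t] makes it negative. *)
have : 0 <= Num.sg c * phi (1 - 3 * (a - t)).
  by rewrite -sgF -normrEsg.
have -> : 1 - 3 * (a - t) = (1 - 3 * a) + 3%:~R * t by ring.
rewrite (rational_linearD _ _ phi_lin) -(ratr_int R 3) rational_linearZ // ratr_int.
move: phit; rewrite /phi'; lra.
Qed.

End perturbed_borda.

Theorem mainTheorem5 (R : realType) (d : measure_display)
    (V : measurableType d) (nu : probability V R)
    (V_infinite : infinite_set [set: V]%classic)
    (nu_atomless : atomless nu) :
  exists (E : set (election V)) (F : swf E),
    CC E /\ MIIA F /\ anonymity nu F /\ neutrality F /\ pareto F /\
    strongly_non_borda nu F.
Proof.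
have [phi [phi_lin phi1 phi_rat]] := @ex_rational_linear_projection R.
have phi1_gt0 : 0 < phi 1 by rewrite phi1.
have F_pareto := @perturbed_borda_pareto _ V R nu phi phi_lin phi1_gt0.
exists (@condorcet_elections _ V), (@perturbed_borda _ V R nu phi _).
split; first by [].
split; first exact: perturbed_borda_MIIA.
split; first exact: perturbed_borda_anonymity.
split; first exact: perturbed_borda_neutrality.
split; first exact: F_pareto.
split.
  (* [phi] has rational values and [phi 1 = 1], so it is not multiplication by [phi 1] at the
     irrational number [pi]. *)
  apply: (@perturbed_borda_not_weakly_borda _ _ _ _ _ phi_lin pi) => //.
  by apply/eqP => E; apply: (@pi_irrationnal R); rewrite -[pi]mulr1 -phi1 -E.
(* In the unanimous election 123, Pareto makes [c1] beat [c2], which rules out the tie rule. *)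
have [e eE] := ex_two_valued_election ranking123 ranking123 (@measurableT _ V).
have eC : e \in @condorcet_elections _ V.
  by apply/mem_set => v; rewrite eE if_same; apply: Or31; exact: listed123.
move=> /(_ (exist _ e eC) c1 c2) tie12.
have : outcome c1 c2 (@perturbed_borda _ V R nu phi _ (exist _ e eC)) = W.
  apply: F_pareto => // v; rewrite /margins /margin /= eE if_same.
  by have [-> -> _] := listed123.
rewrite /outcome; case: ifP => [/win_ntie|_]; first by rewrite tie12.
by case: ifP.
Qed.
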